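(* Let $q\in\mathbb C$ with $0<|q|<1$, $m\in\mathbb N_0$, and $a,b,\gamma,t\in\mathbb C\setminus\{0\}$ with $|t|<1$ and $qa,\,qb,\,\gamma t\notin\{q^{-k}:k\in\mathbb N_0\}$. Then the little $q$-Jacobi polynomials $p_m(x;a,b;q)$ satisfy $$\sum_{n=0}^\infty t^n\frac{(\gamma;q)_n}{(q;q)_n}\,p_m(q^n;a,b;q)=q^{\binom m2}\frac{(\gamma t;q)_\infty}{(t;q)_\infty}(-qa)^m\frac{(qb;q)_m}{(qa;q)_m}\;{}_3\phi_2\left(q^{-m},\,\gamma,\,q^{m+1}ab;\ qb,\,\gamma t;\ q,\frac ta\right).$$
   Context: $\mathbb N_0=\{0,1,2,\dots\}$. $(a;q)_n=\prod_{j=0}^{n-1}(1-aq^j)$ for $n\in\mathbb N_0\cup\{\infty\}$, $(a_1,\dots,a_k;q)_n=\prod_i(a_i;q)_n$, and $${}_r\phi_s(a_1,\dots,a_r;b_1,\dots,b_s;q,w)=\sum_{k\ge0}\frac{(a_1,\dots,a_r;q)_k}{(q,b_1,\dots,b_s;q)_k}\left((-1)^kq^{\binom k2}\right)^{1+s-r}w^k .$$ (The series on the right-hand side of the claim terminates at $k=m$.) The little $q$-Jacobi polynomials are $$p_m(x;a,b;q)={}_2\phi_1\left(q^{-m},q^{m+1}ab;\ qa;\ q,qx\right).$$ *)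

(* Defs.v *)
From Stdlib Require Import Reals ZArith List.
From Coquelicot Require Export Coquelicot.
From mathcomp Require binomial.

Import ListNotations.
Local Open Scope C_scope.

(** Limits and sums of complex sequences as total functions; as for Coquelicot's
    [RInt], the value is the limit (resp. sum) whenever it exists and is
    unspecified otherwise. *)
Definition CLim_seq (u : nat -> C) : C :=
  iota (T := C_CompleteNormedModule)
    (fun l : C => filterlim u eventually (locally l)).

Definition CSeries (u : nat -> C) : C :=
  iota (T := C_CompleteNormedModule) (fun l : C => is_series u l).

Definition Cpowz (x : C) (z : Z) : C :=
  match z with
  | Z0 => 1
  | Zpos p => x ^ Pos.to_nat p
  | Zneg p => / (x ^ Pos.to_nat p)
  end.

Fixpoint qpoch (a q : C) (n : nat) : C :=
  match n with
  | O => 1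
  | S j => qpoch a q j * (1 - a * q ^ j)
  end.

Definition qpoch_inf (a q : C) : C := CLim_seq (qpoch a q).

Definition qpochs (l : list C) (q : C) (n : nat) : C :=
  fold_right Cmult 1 (map (fun a => qpoch a q n) l).

(** Division in [C] is total, so the terms beyond [k = m] of a series with an upper
    parameter [q^-m] vanish, whatever the lower parameters are. *)
Definition qhyp_term (al bl : list C) (q w : C) (k : nat) : C :=
  qpochs al q k / qpochs (q :: bl) q k
  * Cpowz ((- (1)) ^ k * q ^ binomial.binomial k 2)
      (1 + Z.of_nat (length bl) - Z.of_nat (length al))
  * w ^ k.

(** The numbers [r] and [s] of parameters are the lengths of [al] and [bl]. *)
Definition qhyp (al bl : list C) (q w : C) : C :=
  CSeries (qhyp_term al bl q w).

Definition little_qjacobi (m : nat) (x a b q : C) : C :=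
  qhyp [/ (q ^ m); q ^ (m + 1) * a * b] [q * a] q (q * x).

(* Main.v *)
Require Import Defs.
From Stdlib Require Import Reals List Lia Lra.
From Coquelicot Require Import Coquelicot.
From mathcomp Require binomial.
Import ListNotations.
Local Open Scope C_scope.

(** Since [p_m (q^n)] is a finite combination of the powers [(q^k)^n] with [k <= m],
    the left-hand side is a finite combination of the series
    [sum_n (t q^k)^n (gamma;q)_n / (q;q)_n].  By the q-binomial theorem
    ([q_binomial_theorem]) each of them is a quotient of infinite products, which differs
    from [(gamma t;q)_oo / (t;q)_oo] by the factor [(t;q)_k / (gamma t;q)_k].  So the sum
    is [(gamma t;q)_oo / (t;q)_oo] times a terminating 3phi2 with argument [q] and
    parameters [q^-m, q^(m+1) a b, t; q a, gamma t], and what remains is a transformation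
    of this finite sum ([terminating_3phi2_transformation]).

    For the transformation, [(t;q)_k / (gamma t;q)_k] is expanded in the products
    [prod_(i<j) (q^k - q^i)], one form of the q-Chu-Vandermonde sum
    ([qpoch_ratio_expansion]).  After exchanging the two sums, the inner sum over [k] is a
    q-Chu-Vandermonde sum weighted by such a product, and has a closed form
    ([weighted_chu_vandermonde]), which yields the [j]-th term of the 3phi2 on the right.

    The q-binomial theorem follows from the functional equation
    [(1 - t) f(t) = (1 - g t) f(q t)] of [f(t) = sum_n (g;q)_n / (q;q)_n t^n]: iterated, it
    gives [(t;q)_n f(t) = (g t;q)_n f(q^n t)], where [f(q^n t)] tends to 1.  The case
    [g = 0] reads [(t;q)_n f(t) -> 1]; this shows that [(t;q)_oo] exists and is not zero
    when [|t| < 1], and convergence of [(x;q)_n] for every [x] follows. *)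

(** * Finite sums and finite q-products *)

(** [sum_n] at the type [C] itself, so that [ring] and [field] recognise the carrier. *)
Definition csum (u : nat -> C) (n : nat) : C := sum_n u n.

Lemma csum_0 (u : nat -> C) : csum u 0 = u 0%nat.
Proof. exact (sum_O u). Qed.

Lemma csum_S (u : nat -> C) n : csum u (S n) = csum u n + u (S n).
Proof. exact (sum_Sn u n). Qed.

Lemma csum_ext (u v : nat -> C) n :
  (forall k, (k <= n)%nat -> u k = v k) -> csum u n = csum v n.
Proof. exact (sum_n_ext_loc u v n). Qed.

Lemma csum_head (u : nat -> C) n :
  csum u (S n) = u 0%nat + csum (fun k => u (S k)) n.
Proof.
  induction n as [|n IH].
  - rewrite csum_S, !csum_0; ring.
  - rewrite csum_S, IH, csum_S; ring.
Qed.

Lemma csum_plus (u v : nat -> C) n :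
  csum (fun k => u k + v k) n = csum u n + csum v n.
Proof. exact (sum_n_plus u v n). Qed.

Lemma csum_scal (c : C) (u : nat -> C) n :
  csum (fun k => c * u k) n = c * csum u n.
Proof. exact (sum_n_mult_l (K := C_Ring) c u n). Qed.

Lemma csum_switch (u : nat -> nat -> C) m n :
  csum (fun i => csum (u i) n) m = csum (fun j => csum (fun i => u i j) m) n.
Proof. exact (sum_n_switch u m n). Qed.

Lemma csum_extend (u : nat -> C) m n :
  (m <= n)%nat -> (forall k, (m < k)%nat -> u k = 0) -> csum u n = csum u m.
Proof.
  intros Hmn Hu; induction Hmn as [|n Hmn IH]; [reflexivity|].
  rewrite csum_S, IH, Hu by lia; ring.
Qed.

(** Gauss's q-analogue of [(x - y)^n].  It contains [(y;q)_n] as the case [x = 1], and for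
    [x = q^k], [y = 1] it is [q^(kn) (q^-k;q)_n] without the negative powers. *)
Fixpoint qgauss (x y q : C) (n : nat) : C :=
  match n with
  | O => 1
  | S j => qgauss x y q j * (x - y * q ^ j)
  end.

Lemma qgauss_head (x y q : C) n :
  qgauss x y q (S n) = (x - y) * qgauss x (y * q) q n.
Proof.
  induction n as [|n IH]; [simpl; ring|].
  change (qgauss x y q (S (S n))) with (qgauss x y q (S n) * (x - y * q ^ S n)).
  rewrite IH; simpl; ring.
Qed.

Lemma qgauss_scal (c x y q : C) n : qgauss (c * x) (c * y) q n = c ^ n * qgauss x y q n.
Proof. induction n as [|n IH]; simpl; [ring | rewrite IH; ring]. Qed.

Lemma qgauss_vanish (q : C) k j : (k < j)%nat -> qgauss (q ^ k) 1 q j = 0.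
Proof.
  induction 1 as [|j Hj IH]; simpl; [ring | rewrite IH; ring].
Qed.

Lemma qpoch_head (a q : C) n : qpoch a q (S n) = (1 - a) * qpoch (a * q) q n.
Proof.
  induction n as [|n IH]; [simpl; ring|].
  change (qpoch a q (S (S n))) with (qpoch a q (S n) * (1 - a * q ^ S n)).
  rewrite IH; simpl; ring.
Qed.

Lemma qpoch_add (a q : C) n k :
  qpoch a q (n + k) = qpoch a q n * qpoch (a * q ^ n) q k.
Proof.
  induction k as [|k IH].
  - rewrite Nat.add_0_r; simpl; ring.
  - rewrite Nat.add_succ_r; simpl; rewrite IH, Cpow_add_r; ring.
Qed.

Lemma qpoch_vanish (q : C) m k :
  q <> 0 -> (m < k)%nat -> qpoch (/ q ^ m) q k = 0.
Proof.
  intros Hq; induction 1 as [|k Hk IH]; simpl.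
  - rewrite Cinv_l by (apply Cpow_nz; exact Hq). ring.
  - rewrite IH; ring.
Qed.

(** [a] is none of [1, q^-1, q^-2, ...], as required of a lower parameter. *)
Definition qregular (a q : C) : Prop := forall n, qpoch a q n <> 0.

Lemma qregular_factor (a q : C) :
  (forall k, a * q ^ k <> 1) -> qregular a q.
Proof.
  intros H n; induction n as [|n IH]; simpl.
  - exact C1_nz.
  - apply Cmult_neq_0; [exact IH|].
    intros E; apply (H n).
    transitivity (1 - (1 - a * q ^ n)); [ring | rewrite E; ring].
Qed.

Lemma qregular_shift (a q : C) : qregular a q -> qregular (a * q) q.
Proof.
  intros H n E; apply (H (S n)); rewrite qpoch_head, E; ring.
Qed.

Lemma qregular_head (a q : C) : qregular a q -> 1 - a <> 0.
Proof.
  intros H E; apply (H 1%nat); simpl; rewrite <- E; ring.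
Qed.

Lemma qregular_tail (a q : C) n : qregular a q -> 1 - a * q ^ n <> 0.
Proof.
  intros H E; apply (H (S n)); simpl; rewrite E; ring.
Qed.

(** * Two forms of the q-Chu-Vandermonde sum *)

(** Induction on [k]: [qgauss (q^(k+1)) 1 q j] and [qgauss (q^k) 1 q j] differ by
    [- q^k (1 - q^j) qgauss (q^k) 1 q (j-1)], so passing from [k] to [k+1] adds a multiple
    of the same sum for [k] with [g] replaced by [g q], while [t] stays.  The summands with
    [j > k] vanish, and any [N >= k] may serve as the upper bound; this keeps the bounds
    aligned in the induction and makes the two sums in the transformation rectangular. *)
Lemma qpoch_ratio_expansion (q g t : C) k N :
  qregular q q -> qregular (g * t) q -> (k <= N)%nat ->
  csum (fun j => qgauss (q ^ k) 1 q j
                 * (qpoch g q j * t ^ j / (qpoch q q j * qpoch (g * t) q j))) N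
  = qpoch t q k / qpoch (g * t) q k.
Proof.
  intros Hq; revert g N.
  induction k as [|k IH]; intros g N Hd HkN.
  - rewrite (csum_extend _ 0 N), csum_0; [simpl; field | lia |].
    intros j Hj; rewrite (qgauss_vanish q 0 j Hj); ring.
  - destruct N as [|N]; [lia|].
    assert (Hd' : qregular (g * q * t) q).
    { replace (g * q * t) with (g * t * q) by ring. now apply qregular_shift. }
    assert (IH1 := IH g (S N) Hd ltac:(lia)).
    assert (IH2 := IH (g * q) N Hd' ltac:(lia)).
    rewrite csum_head in IH1 |- *.
    assert (Hd0 := qregular_head _ _ Hd).
    rewrite (csum_ext _
      (fun j => qgauss (q ^ k) 1 q (S j)
         * (qpoch g q (S j) * t ^ S j / (qpoch q q (S j) * qpoch (g * t) q (S j)))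
         + (- (q ^ k * t * (1 - g) / (1 - g * t)))
           * (qgauss (q ^ k) 1 q j * (qpoch (g * q) q j * t ^ j
              / (qpoch q q j * qpoch (g * q * t) q j))))).
    + rewrite csum_plus, csum_scal, IH2, Cplus_assoc.
      change (qgauss (q ^ S k) 1 q 0) with (qgauss (q ^ k) 1 q 0).
      rewrite IH1.
      assert (H1 := Hd k). assert (H2 := qregular_tail _ _ k Hd).
      replace (qpoch (g * q * t) q k)
        with (qpoch (g * t) q (S k) / (1 - g * t)).
      2:{ rewrite qpoch_head.
          replace (g * t * q) with (g * q * t) by ring. field. exact Hd0. }
      simpl. field. tauto.
    + intros j _.
      assert (E : qgauss (q ^ S k) 1 q (S j)
                  = qgauss (q ^ k) 1 q (S j)
                    - q ^ k * (1 - q * q ^ j) * qgauss (q ^ k) 1 q j).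
      { rewrite qgauss_head.
        replace (qgauss (q ^ S k) (1 * q) q j)
          with (q ^ j * qgauss (q ^ k) 1 q j).
        - simpl; ring.
        - rewrite <- qgauss_scal; f_equal; simpl; ring. }
      rewrite E, !(qpoch_head g), !(qpoch_head (g * t)).
      replace (g * t * q) with (g * q * t) by ring.
      assert (H1 := Hq j). assert (H2 := Hd' j). assert (H3 := qregular_tail _ _ j Hq).
      simpl. field. tauto.
Qed.

(** Induction on [n], as for the previous lemma: [(q^-(n+1);q)_k] and [(q^-n;q)_k] differ by
    [- q^(-n-1) (1 - q^k) (q^-n;q)_(k-1)], which brings in the sum for [n] with [A] and [c]
    both multiplied by [q]. *)
Lemma q_chu_vandermonde (q : C) n (A c : C) N :
  q <> 0 -> qregular q q -> qregular c q -> (n <= N)%nat ->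
  csum (fun k => qpoch (/ q ^ n) q k * qpoch A q k
                 / (qpoch q q k * qpoch c q k) * q ^ k) N
  = qgauss A c q n / qpoch c q n.
Proof.
  intros Hq0 Hq; revert A c N.
  induction n as [|n IH]; intros A c N Hc HnN.
  - rewrite (csum_extend _ 0 N), csum_0; [simpl; field | lia |].
    intros j Hj; rewrite (qpoch_vanish q 0 j Hq0 Hj). unfold Cdiv; ring.
  - destruct N as [|N]; [lia|].
    assert (Hc' := qregular_shift _ _ Hc).
    assert (IH1 := IH A c (S N) Hc ltac:(lia)).
    assert (IH2 := IH (A * q) (c * q) N Hc' ltac:(lia)).
    rewrite csum_head in IH1 |- *.
    assert (Hc0 := qregular_head _ _ Hc).
    assert (Hqn := Cpow_nz q n Hq0).
    rewrite (csum_ext _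
      (fun j => qpoch (/ q ^ n) q (S j) * qpoch A q (S j)
                 / (qpoch q q (S j) * qpoch c q (S j)) * q ^ (S j)
         + (- (/ q ^ n * (1 - A) / (1 - c)))
           * (qpoch (/ q ^ n) q j * qpoch (A * q) q j
                 / (qpoch q q j * qpoch (c * q) q j) * q ^ j))).
    + rewrite csum_plus, csum_scal, IH2, Cplus_assoc.
      change (qpoch (/ q ^ S n) q 0) with (qpoch (/ q ^ n) q 0).
      rewrite IH1.
      replace (qgauss (A * q) (c * q) q n) with (q ^ n * qgauss A c q n)
        by (rewrite <- qgauss_scal; f_equal; ring).
      assert (H1 := Hc n). assert (H2 := qregular_tail _ _ n Hc).
      replace (qpoch (c * q) q n) with (qpoch c q (S n) / (1 - c))
        by (rewrite qpoch_head; field; exact Hc0).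
      simpl. field. tauto.
    + intros j _.
      assert (E : qpoch (/ q ^ S n) q (S j)
                  = qpoch (/ q ^ n) q (S j)
                    - / q ^ n * / q * (1 - q * q ^ j) * qpoch (/ q ^ n) q j).
      { rewrite qpoch_head.
        replace (/ q ^ S n * q) with (/ q ^ n) by (simpl; field; tauto).
        simpl. field. tauto. }
      rewrite E, !(qpoch_head A), !(qpoch_head c).
      assert (H1 := Hq j). assert (H2 := Hc' j). assert (H3 := qregular_tail _ _ j Hq).
      simpl. field. tauto.
Qed.

(** The weight kills the summands with [k < j], and is peeled off one factor at a time: its
    factor [q^k - 1] cancels the last factor of [(q;q)_k], after which shifting [k] turns
    the sum into the one with [j - 1], [A q] and [c q].  When no factor is left,
    q-Chu-Vandermonde applies. *)
Lemma weighted_chu_vandermonde (q : C) n j (A c : C) :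
  q <> 0 -> qregular q q -> qregular c q ->
  csum (fun k => qpoch (/ q ^ (j + n)) q k * qpoch A q k
                 / (qpoch q q k * qpoch c q k) * q ^ k * qgauss (q ^ k) 1 q j) (j + n)
  = (- (1)) ^ j * q ^ binomial.binomial (S j) 2 * qpoch (/ q ^ (j + n)) q j * qpoch A q j
    * qgauss (A * q ^ j) (c * q ^ j) q n / qpoch c q (j + n).
Proof.
  intros Hq0 Hq; revert A c.
  induction j as [|j IH]; intros A c Hc.
  - rewrite (csum_ext _ (fun k => qpoch (/ q ^ n) q k * qpoch A q k
                 / (qpoch q q k * qpoch c q k) * q ^ k)).
    2:{ intros k _; simpl; ring. }
    change (0 + n)%nat with n.
    rewrite (q_chu_vandermonde q n A c n) by auto.
    change (binomial.binomial 1 2) with 0%nat.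
    simpl; rewrite !Cmult_1_r; unfold Cdiv; ring.
  - change (S j + n)%nat with (S (j + n)).
    assert (Hc' := qregular_shift _ _ Hc).
    assert (Hc0 := qregular_head _ _ Hc).
    assert (Hqn := Cpow_nz q (j + n) Hq0).
    rewrite csum_head.
    rewrite (csum_ext _
      (fun k => - ((1 - / q ^ S (j + n)) * (1 - A) / (1 - c) * q ^ S j)
         * (qpoch (/ q ^ (j + n)) q k * qpoch (A * q) q k
            / (qpoch q q k * qpoch (c * q) q k) * q ^ k * qgauss (q ^ k) 1 q j))).
    + rewrite csum_scal, (IH (A * q) (c * q) Hc').
      rewrite (qgauss_vanish q 0 (S j)) by lia.
      rewrite !(qpoch_head A), !(qpoch_head c), (qpoch_head (/ q ^ S (j + n))).
      replace (/ q ^ S (j + n) * q) with (/ q ^ (j + n)) by (simpl; field; tauto).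
      rewrite (binomial.binS (S j) 1), binomial.bin1.
      change (ssrnat.addn (binomial.binomial (S j) 2) (S j))
        with (binomial.binomial (S j) 2 + S j)%nat.
      rewrite (Cpow_add_r q (binomial.binomial (S j) 2)), (Cpow_S _ (j + n)).
      replace (A * q ^ S j) with (A * q * q ^ j) by (simpl; ring).
      replace (c * q ^ S j) with (c * q * q ^ j) by (simpl; ring).
      assert (H2 := Hc' (j + n)%nat).
      rewrite !(Cpow_S _ j). simpl qpoch at 1 2 3 4. field. tauto.
    + intros k _.
      rewrite (qgauss_head (q ^ S k)).
      replace (qgauss (q ^ S k) (1 * q) q j) with (q ^ j * qgauss (q ^ k) 1 q j)
        by (rewrite <- qgauss_scal; f_equal; simpl; ring).
      rewrite !(qpoch_head A), !(qpoch_head c), (qpoch_head (/ q ^ S (j + n))).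
      replace (/ q ^ S (j + n) * q) with (/ q ^ (j + n)) by (simpl; field; tauto).
      change (qpoch q q (S k)) with (qpoch q q k * (1 - q * q ^ k)).
      assert (H1 := Hq k). assert (H2 := Hc' k). assert (H3 := qregular_tail _ _ k Hq).
      rewrite !(Cpow_S _ (j + n)), !(Cpow_S _ j), !(Cpow_S _ k). field. tauto.
Qed.

(** * Limits and series of complex numbers *)

(** [C] carries several uniform structures with the same topology; fixing the one of the
    normed [C]-module makes the general lemmas on limits and series apply, and [Clim_eps]
    reduces it to [Cmod]. *)
Definition Clim (u : nat -> C) (l : C) : Prop :=
  filterlim u eventually (locally (T := C_NormedModule) l).

Lemma Clim_unique (u : nat -> C) (l1 l2 : C) : Clim u l1 -> Clim u l2 -> l1 = l2.
Proof. exact (filterlim_locally_unique (V := C_NormedModule) u l1 l2). Qed.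

Lemma Clim_ext_loc (u v : nat -> C) (l : C) :
  eventually (fun n => u n = v n) -> Clim u l -> Clim v l.
Proof. intros E; apply filterlim_ext_loc; exact E. Qed.

Lemma Clim_ext (u v : nat -> C) (l : C) : (forall n, u n = v n) -> Clim u l -> Clim v l.
Proof. intros E; apply filterlim_ext; exact E. Qed.

Lemma Clim_const (c : C) : Clim (fun _ => c) c.
Proof. apply filterlim_const. Qed.

Lemma Clim_eps (u : nat -> C) (l : C) :
  Clim u l <-> (forall eps : posreal, eventually (fun n => (Cmod (u n - l) < eps)%R)).
Proof. exact (filterlim_locally_ball_norm (U := C_NormedModule) u l). Qed.

Lemma Clim_mult (u v : nat -> C) (l1 l2 : C) :
  Clim u l1 -> Clim v l2 -> Clim (fun n => u n * v n) (l1 * l2).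
Proof.
  (* Continuity of the product is about the uniform structure of the absolute ring [C],
     which has the same balls of [Cmod] as the normed module. *)
  assert (E : forall w (l : C), Clim w l <->
            filterlim w eventually (locally (T := AbsRing_UniformSpace C_AbsRing) l)).
  { intros w l; rewrite Clim_eps; symmetry.
    exact (filterlim_locally_ball_norm (U := AbsRing_NormedModule C_AbsRing) w l). }
  rewrite !E; intros H1 H2.
  exact (filterlim_comp_2 u v Cmult H1 H2 (filterlim_mult (K := C_AbsRing) l1 l2)).
Qed.

Lemma Clim_shift (u : nat -> C) (l : C) M : Clim (fun n => u (M + n)%nat) l -> Clim u l.
Proof.
  rewrite !Clim_eps; intros H eps.
  destruct (H eps) as [N HN]; exists (M + N)%nat; intros n Hn.
  replace n with (M + (n - M))%nat by lia. apply HN; lia.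
Qed.

Lemma Clim_bound (u : nat -> C) (l : C) (v : nat -> R) :
  (forall n, (Cmod (u n - l) <= v n)%R) -> is_lim_seq v 0 -> Clim u l.
Proof.
  rewrite Clim_eps; intros Hb Hv eps.
  apply is_lim_seq_spec in Hv.
  destruct (Hv eps) as [N HN]; exists N; intros n Hn.
  apply Rle_lt_trans with (1 := Hb n).
  specialize (HN n Hn); rewrite Rminus_0_r in HN.
  apply Rle_lt_trans with (2 := HN), Rle_abs.
Qed.

Lemma CLim_seq_unique (u : nat -> C) (l : C) : Clim u l -> CLim_seq u = l.
Proof.
  intros H; unfold CLim_seq.
  apply (iota_unique (V := C_CompleteNormedModule)); [|exact H].
  intros y Hy; exact (Clim_unique u y l Hy H).
Qed.

Definition Cis_series (u : nat -> C) (l : C) : Prop :=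
  is_series (K := C_AbsRing) (V := C_NormedModule) u l.

Lemma Cis_series_Clim (u : nat -> C) (l : C) : Cis_series u l <-> Clim (csum u) l.
Proof. reflexivity. Qed.

Lemma Cis_series_unique (u : nat -> C) (l1 l2 : C) :
  Cis_series u l1 -> Cis_series u l2 -> l1 = l2.
Proof. apply Clim_unique. Qed.

Lemma CSeries_unique (u : nat -> C) (l : C) : Cis_series u l -> CSeries u = l.
Proof.
  intros H; unfold CSeries.
  apply (iota_unique (V := C_CompleteNormedModule)); [|exact H].
  intros y Hy; exact (Cis_series_unique u y l Hy H).
Qed.

Lemma Cis_series_ext (u v : nat -> C) (l : C) :
  (forall n, u n = v n) -> Cis_series u l -> Cis_series v l.
Proof. exact (is_series_ext (V := C_NormedModule) u v l). Qed.

Lemma Cis_series_plus (u v : nat -> C) (l1 l2 : C) :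
  Cis_series u l1 -> Cis_series v l2 ->
  Cis_series (fun n => u n + v n) (l1 + l2).
Proof. exact (is_series_plus (V := C_NormedModule) u v l1 l2). Qed.

Lemma Cis_series_scal (c : C) (u : nat -> C) (l : C) :
  Cis_series u l -> Cis_series (fun n => c * u n) (c * l).
Proof. exact (is_series_scal (V := C_NormedModule) c u l). Qed.

Lemma Cis_series_tail (u : nat -> C) (l : C) :
  Cis_series u l -> Cis_series (fun n => u (S n)) (l - u 0%nat).
Proof.
  intros H; apply (is_series_incr_1 (V := C_NormedModule)).
  replace (plus (l - u 0%nat : C_NormedModule) (u 0%nat)) with l; [exact H|].
  change (l = l - u 0%nat + u 0%nat); ring.
Qed.

Lemma Cis_series_csum (u : nat -> nat -> C) (l : nat -> C) m :
  (forall k, Cis_series (u k) (l k)) ->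
  Cis_series (fun n => csum (fun k => u k n) m) (csum l m).
Proof.
  intros H; induction m as [|m IH].
  - rewrite csum_0. apply (Cis_series_ext (u 0%nat)); [|apply H].
    intros n; now rewrite csum_0.
  - rewrite csum_S.
    apply (Cis_series_ext (fun n => csum (fun k => u k n) m + u (S m) n)).
    + intros n; now rewrite csum_S.
    + now apply Cis_series_plus.
Qed.

Lemma CSeries_terminating (u : nat -> C) m :
  (forall k, (m < k)%nat -> u k = 0) -> CSeries u = csum u m.
Proof.
  intros H; apply CSeries_unique, Cis_series_Clim.
  apply (Clim_ext_loc (fun _ => csum u m)); [|apply Clim_const].
  exists m; intros n Hn; symmetry; exact (csum_extend u m n Hn H).
Qed.

Lemma Cis_series_bound (u : nat -> C) (l : C) (v : nat -> R) (B : R) :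
  Cis_series u l -> (forall n, (Cmod (u n) <= v n)%R) -> is_series v B ->
  (Cmod l <= B)%R.
Proof.
  intros Hu Hb Hv.
  assert (H1 : is_lim_seq (fun n => Cmod (csum u n)) (Cmod l)).
  { exact (filterlim_comp _ _ _ (sum_n u) norm _ _ _ Hu
             (filterlim_norm (V := C_NormedModule) l)). }
  assert (H2 : is_lim_seq (sum_n v) B) by exact Hv.
  refine (is_lim_seq_le _ _ (Cmod l) B _ H1 H2).
  intros n; induction n as [|n IH].
  - rewrite csum_0, sum_O; apply Hb.
  - rewrite csum_S, sum_Sn.
    apply Rle_trans with (1 := Cmod_triangle _ _).
    apply Rplus_le_compat; [exact IH | apply Hb].
Qed.

(** Only a ratio bound from some rank on is assumed, and zero terms are allowed, since
    [(g;q)_n] vanishes eventually when [g] is a negative power of [q]. *)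
Lemma geometric_bound (u : nat -> R) (r : R) N :
  (0 < r)%R -> (forall n, (0 <= u n)%R) ->
  (forall n, (N <= n)%nat -> (u (S n) <= r * u n)%R) ->
  exists K, forall n, (u n <= K * r ^ n)%R.
Proof.
  intros Hr; revert u; induction N as [|N IH]; intros u Hpos Hu.
  - exists (u 0%nat); induction n as [|n IHn]; simpl; [lra|].
    apply Rle_trans with (1 := Hu n (Nat.le_0_l n)).
    apply Rle_trans with (r * (u 0%nat * r ^ n))%R; [|lra].
    apply Rmult_le_compat_l; lra.
  - destruct (IH (fun n => u (S n))) as [K HK].
    + intros n; apply Hpos.
    + intros n Hn; apply Hu; lia.
    + exists (Rmax (u 0%nat) (K / r)); intros [|n].
      * simpl; rewrite Rmult_1_r; apply Rmax_l.
      * apply Rle_trans with (1 := HK n).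
        replace (K * r ^ n)%R with (K / r * r ^ S n)%R by (simpl; field; lra).
        apply Rmult_le_compat_r; [apply pow_le; lra | apply Rmax_r].
Qed.

(** * The q-binomial theorem *)

Section QBinomial.

Variable q : C.
Hypothesis Hq : (0 < Cmod q < 1)%R.

Lemma base_nonzero : q <> 0.
Proof. apply Cmod_gt_0; apply Hq. Qed.

Lemma base_power_lim : is_lim_seq (fun n => (Cmod q ^ n)%R) 0.
Proof. apply is_lim_seq_geom; rewrite Rabs_pos_eq; lra. Qed.

Lemma base_regular : qregular q q.
Proof.
  apply qregular_factor; intros k E.
  assert (H : Cmod (q * q ^ k) = 1%R) by (rewrite E; apply Cmod_1).
  rewrite Cmod_mult, Cmod_pow in H.
  assert (H1 := pow_le (Cmod q) k (Rlt_le _ _ (proj1 Hq))).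
  assert (H2 : (Cmod q ^ k <= 1)%R).
  { rewrite <- (pow1 k); apply pow_incr; lra. }
  nra.
Qed.

Definition qbin_coef (g : C) (n : nat) : C := qpoch g q n / qpoch q q n.

Lemma qbin_coef_S (g : C) n :
  qbin_coef g (S n) * (1 - q * q ^ n) = qbin_coef g n * (1 - g * q ^ n).
Proof.
  unfold qbin_coef; simpl.
  assert (H1 := base_regular n). assert (H2 := qregular_tail _ _ n base_regular).
  field; tauto.
Qed.

(** The ratio of consecutive terms tends to [|t|], hence is eventually below any
    [r > |t|]; [r] is the midpoint of [|t|] and 1. *)
Lemma qbin_geometric_bound (g t : C) :
  (Cmod t < 1)%R ->
  exists K r, (0 < r < 1)%R /\ forall n, (Cmod (t ^ n * qbin_coef g n) <= K * r ^ n)%R.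
Proof.
  intros Ht.
  assert (Ht0 := Cmod_ge_0 t). assert (Hg0 := Cmod_ge_0 g).
  set (r := ((1 + Cmod t) / 2)%R).
  assert (Hr : (0 < r < 1)%R) by (unfold r; lra).
  (* As soon as [|q|^n (1 + |g|) < r - |t|], the inequality
     [|t| (1 + |g| |q|^n) <= r (1 - |q|^n)] holds. *)
  assert (Hlim : is_lim_seq (fun n => Cmod q ^ n * (1 + Cmod g))%R 0).
  { replace 0%R with (0 * (1 + Cmod g))%R by ring.
    apply (is_lim_seq_scal_r _ (1 + Cmod g)%R 0%R), base_power_lim. }
  apply is_lim_seq_spec in Hlim.
  assert (Heps : (0 < r - Cmod t)%R) by (unfold r; lra).
  destruct (Hlim (mkposreal _ Heps)) as [N HN]; simpl in HN.
  destruct (geometric_bound (fun n => Cmod (t ^ n * qbin_coef g n)) r N) as [K HK].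
  - lra.
  - intros n; apply Cmod_ge_0.
  - intros n Hn.
    specialize (HN n Hn); rewrite Rminus_0_r, Rabs_pos_eq in HN.
    2:{ apply Rmult_le_pos; [apply pow_le|]; lra. }
    assert (Hqn := pow_le (Cmod q) n (Rlt_le _ _ (proj1 Hq))).
    assert (H1 : (1 - Cmod q ^ n <= Cmod (1 - q * q ^ n))%R).
    { apply Rle_trans with (Cmod 1 - Cmod (q * q ^ n))%R.
      - rewrite Cmod_1, Cmod_mult, Cmod_pow. nra.
      - assert (H := Cmod_triangle (1 - q * q ^ n) (q * q ^ n)).
        replace (1 - q * q ^ n + q * q ^ n) with (RtoC 1) in H by ring.
        lra. }
    assert (H2 : (Cmod (1 - g * q ^ n) <= 1 + Cmod g * Cmod q ^ n)%R).
    { assert (H := Cmod_triangle 1 (- (g * q ^ n))).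
      rewrite Cmod_opp, Cmod_1, Cmod_mult, Cmod_pow in H. exact H. }
    assert (Hden : (0 < Cmod (1 - q * q ^ n))%R).
    { apply Cmod_gt_0, qregular_tail, base_regular. }
    apply Rmult_le_reg_r with (1 := Hden).
    rewrite <- Cmod_mult.
    replace (t ^ S n * qbin_coef g (S n) * (1 - q * q ^ n))
      with (t ^ n * qbin_coef g n * (t * (1 - g * q ^ n))).
    2:{ transitivity (t * t ^ n * (qbin_coef g (S n) * (1 - q * q ^ n)));
          [rewrite qbin_coef_S; ring | simpl; ring]. }
    rewrite (Cmod_mult (t ^ n * qbin_coef g n)), (Cmod_mult t).
    assert (H3 := Cmod_ge_0 (t ^ n * qbin_coef g n)).
    assert (H4 : (Cmod t * Cmod (1 - g * q ^ n) <= r * Cmod (1 - q * q ^ n))%R).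
    { apply Rle_trans with (Cmod t * (1 + Cmod g * Cmod q ^ n))%R;
        [apply Rmult_le_compat_l; assumption|].
      apply Rle_trans with (r * (1 - Cmod q ^ n))%R;
        [|apply Rmult_le_compat_l; lra].
      assert (0 <= Cmod g * Cmod q ^ n)%R by now apply Rmult_le_pos.
      nra. }
    apply Rle_trans with
      (Cmod (t ^ n * qbin_coef g n) * (r * Cmod (1 - q * q ^ n)))%R.
    + now apply Rmult_le_compat_l.
    + apply Req_le; ring.
  - exists K, r; split; assumption.
Qed.

Definition qbin (g t : C) : C := CSeries (fun n => t ^ n * qbin_coef g n).

Lemma qbin_series (g t : C) :
  (Cmod t < 1)%R -> Cis_series (fun n => t ^ n * qbin_coef g n) (qbin g t).
Proof.
  intros Ht.
  destruct (qbin_geometric_bound g t Ht) as (K & r & Hr & HK).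
  destruct (ex_series_le (V := C_CompleteNormedModule)
              (fun n => t ^ n * qbin_coef g n) (fun n => K * r ^ n)%R HK) as [l Hl].
  - apply (ex_series_scal_l (K := R_AbsRing) (V := R_NormedModule) K).
    apply ex_series_geom; rewrite Rabs_pos_eq; lra.
  - unfold qbin; rewrite (CSeries_unique _ l Hl); exact Hl.
Qed.

Lemma Cmod_scaled (t : C) n : (Cmod t < 1)%R -> (Cmod (t * q ^ n) < 1)%R.
Proof.
  intros Ht; rewrite Cmod_mult, Cmod_pow.
  assert (Ht0 := Cmod_ge_0 t).
  assert (H1 := pow_le (Cmod q) n (Rlt_le _ _ (proj1 Hq))).
  assert (H2 : (Cmod q ^ n <= 1)%R).
  { rewrite <- (pow1 n); apply pow_incr; lra. }
  nra.
Qed.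

(** The recurrence [c_(n+1) (1 - q^(n+1)) = c_n (1 - g q^n)] of the coefficients, summed
    over [n], says that [f(t) - f(q t) = t f(t) - g t f(q t)]. *)
Lemma qbin_functional (g t : C) :
  (Cmod t < 1)%R -> (1 - t) * qbin g t = (1 - g * t) * qbin g (t * q).
Proof.
  intros Ht.
  assert (Htq : (Cmod (t * q) < 1)%R).
  { replace (t * q) with (t * q ^ 1) by (simpl; ring). now apply Cmod_scaled. }
  assert (Hf := qbin_series g t Ht). assert (Hh := qbin_series g (t * q) Htq).
  assert (E : qbin g t - qbin g (t * q) = t * qbin g t - g * t * qbin g (t * q)).
  { transitivity ((qbin g t - t ^ 0 * qbin_coef g 0)
                  + (- (1)) * (qbin g (t * q) - (t * q) ^ 0 * qbin_coef g 0));
      [simpl; ring|].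
    transitivity (t * qbin g t + (- (g * t)) * qbin g (t * q)); [|ring].
    eapply Cis_series_unique.
    - apply Cis_series_plus; [|apply Cis_series_scal];
        [exact (Cis_series_tail _ _ Hf) | exact (Cis_series_tail _ _ Hh)].
    - apply (Cis_series_ext (fun n => t * (t ^ n * qbin_coef g n)
               + (- (g * t)) * ((t * q) ^ n * qbin_coef g n))).
      2:{ apply Cis_series_plus; now apply Cis_series_scal. }
      intros n; rewrite !Cpow_mult_l.
      transitivity (t * t ^ n * (qbin_coef g n * (1 - g * q ^ n))); [ring|].
      rewrite <- qbin_coef_S; simpl; ring. }
  transitivity (qbin g t - t * qbin g t); [ring|].
  transitivity (qbin g (t * q) - g * t * qbin g (t * q)); [|ring].
  transitivity (qbin g t - qbin g (t * q) + (qbin g (t * q) - t * qbin g t)); [ring|].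
  rewrite E; ring.
Qed.

Lemma qbin_iterate (g t : C) n :
  (Cmod t < 1)%R ->
  qpoch t q n * qbin g t = qpoch (g * t) q n * qbin g (t * q ^ n).
Proof.
  intros Ht; induction n as [|n IH].
  - simpl. replace (t * 1) with t by ring. ring.
  - simpl.
    transitivity (qpoch t q n * qbin g t * (1 - t * q ^ n)); [ring|].
    assert (E := qbin_functional g (t * q ^ n) (Cmod_scaled t n Ht)).
    replace (t * q ^ n * q) with (t * (q * q ^ n)) in E by ring.
    rewrite IH.
    transitivity (qpoch (g * t) q n * ((1 - t * q ^ n) * qbin g (t * q ^ n))); [ring|].
    rewrite E; ring.
Qed.

(** Every term of positive degree of [f(q^n t)] carries a factor at least as small as
    [q^n], and the terms of [f(t)] are bounded by a geometric series. *)
Lemma qbin_scaled_lim (g t : C) :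
  (Cmod t < 1)%R -> Clim (fun n => qbin g (t * q ^ n)) 1.
Proof.
  intros Ht.
  destruct (qbin_geometric_bound g t Ht) as (K & r & Hr & HK).
  assert (Hgeom : is_series (fun n => K * r ^ S n)%R (K * r * / (1 - r))%R).
  { apply (is_series_ext (fun n => scal (K * r)%R (r ^ n)%R)).
    - intros n; change (K * r * r ^ n = K * (r * r ^ n))%R; ring.
    - apply (is_series_scal_l (K := R_AbsRing) (V := R_NormedModule)).
      apply is_series_geom; rewrite Rabs_pos_eq; lra. }
  apply (Clim_bound _ _ (fun n => Cmod q ^ n * (K * r * / (1 - r)))%R).
  - intros n.
    assert (Hs := Cis_series_tail _ _ (qbin_series g _ (Cmod_scaled t n Ht))).
    cbv beta in Hs.
    replace ((t * q ^ n) ^ 0 * qbin_coef g 0) with (RtoC 1) in Hs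
      by (unfold qbin_coef; simpl; field).
    apply (Cis_series_bound _ _ (fun k => Cmod q ^ n * (K * r ^ S k))%R _ Hs).
    + intros k.
      rewrite Cpow_mult_l.
      replace (t ^ S k * (q ^ n) ^ S k * qbin_coef g (S k))
        with (q ^ n * ((q ^ n) ^ k * (t ^ S k * qbin_coef g (S k))))
        by (simpl; ring).
      rewrite (Cmod_mult (q ^ n)), (Cmod_mult ((q ^ n) ^ k)), <- Cpow_mult_r, !Cmod_pow.
      assert (H1 := pow_le (Cmod q) n (Rlt_le _ _ (proj1 Hq))).
      assert (H2 := pow_le (Cmod q) (n * k) (Rlt_le _ _ (proj1 Hq))).
      assert (H3 : (Cmod q ^ (n * k) <= 1)%R).
      { rewrite <- (pow1 (n * k)); apply pow_incr; lra. }
      apply Rmult_le_compat_l; [exact H1|].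
      apply Rle_trans with (2 := HK (S k)).
      assert (H4 := Cmod_ge_0 (t ^ S k * qbin_coef g (S k))). nra.
    + exact (is_series_scal_l (K := R_AbsRing) (V := R_NormedModule) _ _ _ Hgeom).
  - replace 0%R with (0 * (K * r * / (1 - r)))%R by ring.
    apply (is_lim_seq_scal_r _ (K * r * / (1 - r))%R 0%R), base_power_lim.
Qed.

(** Euler's series [e(t) = sum_n t^n / (q;q)_n] satisfies [(t;q)_n e(t) = e(q^n t) -> 1], so
    [e(t)] cannot be zero and [(t;q)_n] tends to [1 / e(t)]. *)
Lemma qpoch_lim_nonzero (t : C) :
  (Cmod t < 1)%R -> exists l : C, l <> 0 /\ Clim (qpoch t q) l.
Proof.
  intros Ht.
  assert (H : Clim (fun n => qpoch t q n * qbin 0 t) 1).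
  { apply (Clim_ext (fun n => qbin 0 (t * q ^ n))); [|now apply qbin_scaled_lim].
    intros n; rewrite qbin_iterate by exact Ht.
    replace (qpoch (0 * t) q n) with (RtoC 1); [ring|].
    induction n as [|n IH]; simpl; [|rewrite <- IH]; ring. }
  assert (Hnz : qbin 0 t <> 0).
  { intros E; rewrite E in H. apply C1_nz.
    apply (Clim_unique _ _ _ H).
    apply (Clim_ext (fun _ => 0)); [intros n; ring | apply Clim_const]. }
  exists (/ qbin 0 t); split; [|].
  { intros E; apply C1_nz; rewrite <- (Cinv_r _ Hnz), E; ring. }
  replace (/ qbin 0 t) with (1 * / qbin 0 t) by ring.
  apply (Clim_ext (fun n => qpoch t q n * qbin 0 t * / qbin 0 t)).
  - intros n; field; exact Hnz.
  - apply Clim_mult; [exact H | apply Clim_const].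
Qed.

(** The first factors are split off until the remaining product starts inside the unit
    disk. *)
Lemma qpoch_inf_lim (x : C) : Clim (qpoch x q) (qpoch_inf x q).
Proof.
  enough (exists l : C, Clim (qpoch x q) l) as [l Hl].
  { unfold qpoch_inf; rewrite (CLim_seq_unique _ l Hl); exact Hl. }
  assert (HM : exists M, (Cmod (x * q ^ M) < 1)%R).
  { assert (Hlim : is_lim_seq (fun n => Cmod q ^ n * Cmod x)%R 0).
    { replace 0%R with (0 * Cmod x)%R by ring.
      apply (is_lim_seq_scal_r _ (Cmod x) 0%R), base_power_lim. }
    apply is_lim_seq_spec in Hlim.
    destruct (Hlim (mkposreal 1 Rlt_0_1)) as [M HM]; exists M.
    specialize (HM M (le_n M)); simpl in HM.
    rewrite Rminus_0_r in HM.
    rewrite Cmod_mult, Cmod_pow, Rmult_comm.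
    apply Rle_lt_trans with (2 := HM), Rle_abs. }
  destruct HM as [M HM].
  destruct (qpoch_lim_nonzero _ HM) as (l & _ & Hl).
  exists (qpoch x q M * l); apply (Clim_shift _ _ M).
  apply (Clim_ext (fun n => qpoch x q M * qpoch (x * q ^ M) q n)).
  - intros n; now rewrite qpoch_add.
  - apply Clim_mult; [apply Clim_const | exact Hl].
Qed.

Lemma qpoch_inf_nonzero (t : C) : (Cmod t < 1)%R -> qpoch_inf t q <> 0.
Proof.
  intros Ht; destruct (qpoch_lim_nonzero t Ht) as (l & Hnz & Hl).
  now rewrite (Clim_unique _ _ _ (qpoch_inf_lim t) Hl).
Qed.

Lemma qpoch_inf_split (x : C) k :
  qpoch_inf x q = qpoch x q k * qpoch_inf (x * q ^ k) q.
Proof.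
  apply (Clim_unique (qpoch x q)); [apply qpoch_inf_lim|].
  apply (Clim_shift _ _ k).
  apply (Clim_ext (fun n => qpoch x q k * qpoch (x * q ^ k) q n)).
  - intros n; now rewrite qpoch_add.
  - apply Clim_mult; [apply Clim_const | apply qpoch_inf_lim].
Qed.

Lemma q_binomial_theorem (g t : C) :
  (Cmod t < 1)%R ->
  Cis_series (fun n => t ^ n * qbin_coef g n) (qpoch_inf (g * t) q / qpoch_inf t q).
Proof.
  intros Ht.
  replace (qpoch_inf (g * t) q / qpoch_inf t q) with (qbin g t);
    [now apply qbin_series|].
  assert (Hnz := qpoch_inf_nonzero t Ht).
  assert (E : qpoch_inf t q * qbin g t = qpoch_inf (g * t) q * 1).
  { eapply Clim_unique.
    - apply Clim_mult; [apply qpoch_inf_lim | apply Clim_const].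
    - apply (Clim_ext (fun n => qpoch (g * t) q n * qbin g (t * q ^ n))).
      + intros n; symmetry; now apply qbin_iterate.
      + apply Clim_mult; [apply qpoch_inf_lim | now apply qbin_scaled_lim]. }
  rewrite Cmult_1_r in E. rewrite <- E. field. exact Hnz.
Qed.

End QBinomial.

(** * The transformation of the terminating 3phi2 series *)

Lemma binomial2_S n :
  binomial.binomial (S n) 2 = (binomial.binomial n 2 + n)%nat.
Proof. rewrite binomial.binS, binomial.bin1; reflexivity. Qed.

Lemma binomial2_add j n :
  binomial.binomial (j + n) 2
  = (binomial.binomial j 2 + binomial.binomial n 2 + j * n)%nat.
Proof.
  induction n as [|n IH].
  - change (binomial.binomial 0 2) with 0%nat; rewrite Nat.add_0_r; lia.
  - rewrite Nat.add_succ_r, !binomial2_S, IH; lia.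
Qed.

(** The factor [z q^n - q^i] is [- q^i (1 - z q^(n-i))], so the factors of [(z q;q)_n] appear
    in reverse order. *)
Lemma qgauss_reverse (z q : C) n :
  qgauss (z * q ^ n) 1 q n
  = (- (1)) ^ n * q ^ binomial.binomial n 2 * qpoch (z * q) q n.
Proof.
  revert z; induction n as [|n IH]; intros z.
  - change (binomial.binomial 0 2) with 0%nat; simpl; ring.
  - rewrite binomial2_S, qpoch_head, Cpow_add_r; simpl.
    replace (z * (q * q ^ n)) with (z * q * q ^ n) by ring.
    rewrite IH; ring.
Qed.

(** Both sides are sums over [j <= m] once [(t;q)_k / (g t;q)_k] has been expanded and the
    order of summation exchanged, and they agree term by term. *)
Lemma terminating_3phi2_transformation (q a b g t : C) m :
  q <> 0 -> a <> 0 ->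
  qregular q q -> qregular (q * a) q -> qregular (q * b) q -> qregular (g * t) q ->
  csum (fun k => qpoch (/ q ^ m) q k * qpoch (q ^ (m + 1) * a * b) q k
                 / (qpoch q q k * qpoch (q * a) q k) * q ^ k
                 * (qpoch t q k / qpoch (g * t) q k)) m
  = q ^ binomial.binomial m 2 * (- (q * a)) ^ m
    * (qpoch (q * b) q m / qpoch (q * a) q m)
    * csum (fun j => qpoch (/ q ^ m) q j * qpoch g q j * qpoch (q ^ (m + 1) * a * b) q j
                     / (qpoch q q j * qpoch (q * b) q j * qpoch (g * t) q j)
                     * (t / a) ^ j) m.
Proof.
  intros Hq0 Ha0 Hq Ha Hb Hg.
  set (A := q ^ (m + 1) * a * b).
  rewrite (csum_ext _ (fun k => csum (fun j =>
    qpoch g q j * t ^ j / (qpoch q q j * qpoch (g * t) q j)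
    * (qpoch (/ q ^ m) q k * qpoch A q k / (qpoch q q k * qpoch (q * a) q k)
       * q ^ k * qgauss (q ^ k) 1 q j)) m)).
  2:{ intros k Hk.
      rewrite <- (qpoch_ratio_expansion q g t k m Hq Hg Hk), <- csum_scal.
      apply csum_ext; intros j _; ring. }
  rewrite csum_switch, <- csum_scal.
  apply csum_ext; intros j Hj.
  rewrite csum_scal.
  assert (Hn : exists n, m = (j + n)%nat) by (exists (m - j)%nat; lia).
  destruct Hn as [n ->].
  rewrite (weighted_chu_vandermonde q n j A (q * a) Hq0 Hq Ha).
  (* Taking the common factor [a q^(j+1)] out of the Gauss product leaves
     [qgauss (q^j b q^n) 1 q n], whose reversal is the quotient of [(q b;q)_(j+n)] by
     [(q b;q)_j]. *)
  replace (A * q ^ j) with (a * q ^ S j * (q ^ j * b * q ^ n))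
    by (unfold A; rewrite !Cpow_add_r; simpl; ring).
  replace (q * a * q ^ j) with (a * q ^ S j * 1) by (simpl; ring).
  rewrite qgauss_scal, qgauss_reverse, (qpoch_add (q * b) q j n).
  replace (q ^ j * b * q) with (q * b * q ^ j) by ring.
  replace ((t / a) ^ j) with (t ^ j / a ^ j)
    by (unfold Cdiv; rewrite Cpow_mult_l, Cpow_inv by exact Ha0; reflexivity).
  replace (- (q * a)) with (- (1) * (q * a)) by ring.
  rewrite binomial2_S, binomial2_add, !Cpow_mult_l, !Cpow_add_r, Cpow_mult_r, Cpow_S,
    !Cpow_mult_l.
  assert (H1 := Hq j). assert (H2 := Ha (j + n)%nat). assert (H3 := Hb j).
  assert (H4 := Hg j). assert (H5 := Cpow_nz a j Ha0).
  field. tauto.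
Qed.

(** * The generating function *)

Lemma qhyp_2phi1_terminating (q a c w : C) (m : nat) :
  q <> 0 ->
  qhyp [/ (q ^ m); a] [c] q w
  = csum (fun k => qpoch (/ q ^ m) q k * qpoch a q k
                   / (qpoch q q k * qpoch c q k) * w ^ k) m.
Proof.
  intros Hq0; unfold qhyp.
  assert (E : forall k, qhyp_term [/ (q ^ m); a] [c] q w k
    = qpoch (/ q ^ m) q k * qpoch a q k / (qpoch q q k * qpoch c q k) * w ^ k).
  { intros k; unfold qhyp_term, qpochs; simpl.
    rewrite !Cmult_1_r; reflexivity. }
  rewrite (CSeries_terminating _ m).
  - apply csum_ext; intros k _; apply E.
  - intros k Hk; rewrite E, (qpoch_vanish q m k Hq0 Hk); unfold Cdiv; ring.
Qed.

Lemma qhyp_3phi2_terminating (q a b c d w : C) (m : nat) :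
  q <> 0 ->
  qhyp [/ (q ^ m); a; b] [c; d] q w
  = csum (fun k => qpoch (/ q ^ m) q k * qpoch a q k * qpoch b q k
                   / (qpoch q q k * qpoch c q k * qpoch d q k) * w ^ k) m.
Proof.
  intros Hq0; unfold qhyp.
  assert (E : forall k, qhyp_term [/ (q ^ m); a; b] [c; d] q w k
    = qpoch (/ q ^ m) q k * qpoch a q k * qpoch b q k
      / (qpoch q q k * qpoch c q k * qpoch d q k) * w ^ k).
  { intros k; unfold qhyp_term, qpochs; simpl.
    rewrite !Cmult_1_r, !Cmult_assoc; reflexivity. }
  rewrite (CSeries_terminating _ m).
  - apply csum_ext; intros k _; apply E.
  - intros k Hk; rewrite E, (qpoch_vanish q m k Hq0 Hk); unfold Cdiv; ring.
Qed.

Lemma qregular_of_not_inverse_power (q x : C) :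
  q <> 0 -> (forall k : nat, x <> / (q ^ k)) -> qregular x q.
Proof.
  intros Hq0 H; apply qregular_factor; intros k E; apply (H k).
  assert (Hk := Cpow_nz q k Hq0).
  transitivity (x * q ^ k / q ^ k); [field; exact Hk|].
  rewrite E; field; exact Hk.
Qed.

Theorem theorem8p25 :
  forall (q : C) (m : nat) (a b gamma t : C),
    (0 < Cmod q < 1)%R ->
    a <> 0 -> b <> 0 -> gamma <> 0 -> t <> 0 ->
    (Cmod t < 1)%R ->
    (forall k : nat, q * a <> / (q ^ k)) ->
    (forall k : nat, q * b <> / (q ^ k)) ->
    (forall k : nat, gamma * t <> / (q ^ k)) ->
    is_series
      (fun n : nat =>
         t ^ n * (qpoch gamma q n / qpoch q q n) * little_qjacobi m (q ^ n) a b q)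
      (q ^ binomial.binomial m 2
       * (qpoch_inf (gamma * t) q / qpoch_inf t q)
       * (- (q * a)) ^ m
       * (qpoch (q * b) q m / qpoch (q * a) q m)
       * qhyp [/ (q ^ m); gamma; q ^ (m + 1) * a * b] [q * b; gamma * t] q (t / a)).
Proof.
  intros q m a b g t Hq Ha0 _ _ _ Ht Ha Hb Hg.
  assert (Hq0 := base_nonzero q Hq).
  apply (qregular_of_not_inverse_power q _ Hq0) in Ha, Hb, Hg.
  assert (Hqq := base_regular q Hq).
  rewrite qhyp_3phi2_terminating by exact Hq0.
  set (A := q ^ (m + 1) * a * b).
  set (coef := fun k => qpoch (/ q ^ m) q k * qpoch A q k
                        / (qpoch q q k * qpoch (q * a) q k) * q ^ k).
  assert (H := Cis_series_csum
    (fun k n => coef k * ((t * q ^ k) ^ n * qbin_coef q g n))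
    (fun k => coef k * (qpoch_inf (g * (t * q ^ k)) q / qpoch_inf (t * q ^ k) q)) m
    (fun k => Cis_series_scal _ _ _
       (q_binomial_theorem q Hq g _ (Cmod_scaled q Hq t k Ht)))).
  match goal with |- is_series _ ?rhs => replace rhs with
    (csum (fun k => coef k
       * (qpoch_inf (g * (t * q ^ k)) q / qpoch_inf (t * q ^ k) q)) m) end.
  - refine (Cis_series_ext _ _ _ _ H); intros n; cbv beta.
    unfold little_qjacobi; rewrite qhyp_2phi1_terminating by exact Hq0.
    rewrite <- csum_scal; apply csum_ext; intros k _.
    unfold coef, qbin_coef; fold A.
    rewrite !Cpow_mult_l, <- !Cpow_mult_r, (Nat.mul_comm k n). ring.
  - transitivity (qpoch_inf (g * t) q / qpoch_inf t q
      * csum (fun k => coef k * (qpoch t q k / qpoch (g * t) q k)) m).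
    + rewrite <- csum_scal; apply csum_ext; intros k _.
      rewrite (qpoch_inf_split q Hq (g * t) k), (qpoch_inf_split q Hq t k).
      replace (g * (t * q ^ k)) with (g * t * q ^ k) by ring.
      assert (H1 := qpoch_inf_nonzero q Hq _ (Cmod_scaled q Hq t k Ht)).
      assert (H2 := qpoch_inf_nonzero q Hq _ Ht).
      rewrite (qpoch_inf_split q Hq t k) in H2.
      assert (H3 : qpoch t q k <> 0) by (intros E; apply H2; rewrite E; ring).
      assert (H4 := Hg k).
      field. tauto.
    + unfold coef, A.
      rewrite (terminating_3phi2_transformation q a b g t m Hq0 Ha0 Hqq Ha Hb Hg).
      ring.
Qed.
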